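(* Let $R$ be a crystallographic root system in a finite-dimensional Euclidean space $\mathfrak a$ with Weyl group $W$ and fixed positive subsystem $R_+$, let $k\ge0$ be a multiplicity function on $R$, and let $\rho=\rho(k)=\frac12\sum_{\alpha\in R_+}k_\alpha\alpha$. Then for all $\lambda\in\mathfrak a_{\mathbb C}$ and all $t\in\mathfrak a$, $$\bigl|F_{\lambda+\rho}(k;t)\bigr|\le e^{\max_{w\in W}\mathrm{Re}\langle w\lambda,t\rangle}.$$
   Context: $\langle\cdot,\cdot\rangle$ is the inner product of $\mathfrak a$, extended complex-bilinearly to $\mathfrak a_{\mathbb C}$. $R$ need not be reduced; $\sigma_\alpha$ is the orthogonal reflection in $\alpha^\perp$; a multiplicity function $k=(k_\alpha)_{\alpha\in R}$ is constant on $W$-orbits, and $k\ge0$ means all $k_\alpha\ge0$. The Cherednik operators are $$T_\xi(k)=\partial_\xi+\sum_{\alpha\in R_+}k_\alpha\langle\alpha,\xi\rangle\frac{1}{1-e^{-\alpha}}(1-\sigma_\alpha)-\langle\rho(k),\xi\rangle\quad(\xi\in\mathfrak a),$$ with $e^\lambda(t)=e^{\langle\lambda,t\rangle}$. The Cherednik-Opdam kernel $G(\lambda,k;t)$ is (Opdam) the unique function, holomorphic in $(\lambda,t)\in\mathfrak a_{\mathbb C}\times U$ for a $W$-invariant tubular neighborhood $U$ of $\mathfrak a$ in $\mathfrak a_{\mathbb C}$, with $T_\xi(k)G(\lambda,k;\cdot)=\langle\lambda,\xi\rangle G(\lambda,k;\cdot)$ for all $\xi\in\mathfrak a,\lambda\in\mathfrak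 a_{\mathbb C}$ and $G(\lambda,k;0)=1$. The hypergeometric function is $F_\lambda(k;t)=F(\lambda,k;t)=\frac1{|W|}\sum_{w\in W}G(\lambda,k;w^{-1}t)$. *)

(* Defs.v *)
From HB Require Import structures.
From mathcomp Require Import all_boot all_order all_algebra finmap.
From mathcomp Require Import all_classical all_reals all_analysis.
From mathcomp Require Import complex.
From mathcomp Require Import ring.
Import numFieldNormedType.Exports.

Set Implicit Arguments.
Unset Strict Implicit.
Unset Printing Implicit Defensive.

Import Order.TTheory GRing.Theory Num.Theory.

Local Open Scope classical_set_scope.
Local Open Scope ring_scope.
Local Open Scope complex_scope.

(* The topology and norm that every numFieldType carries, made canonical on
   the concrete type R[i]; differentiability of maps between normed modules
   over R[i] is then complex differentiability. *)
HB.instance Definition _ (R : rcfType) := PseudoPointedMetric.copy R[i] R[i]^o.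
HB.instance Definition _ (R : rcfType) := GRing.ComAlgebra.copy R[i] R[i]^o.
HB.instance Definition _ (R : rcfType) := Vector.copy R[i] R[i]^o.
HB.instance Definition _ (R : rcfType) := NormedModule.copy R[i] R[i]^o.

(* The Euclidean space is R^n, as column vectors, and its complexification is
   C^n.  The form is bilinear, not Hermitian, when K is R[i]. *)
Definition dot {K : comPzRingType} {n : nat} (u v : 'cV[K]_n) : K :=
  \sum_(i < n) u i 0 * v i 0.

Definition complexify {R : realType} {m n : nat} (A : 'M[R]_(m, n)) :
    'M[R[i]]_(m, n) :=
  map_mx (real_complex R) A.

Definition cexp {R : realType} (z : R[i]) : R[i] :=
  (expR (complex.Re z))%:C * (cos (complex.Im z) +i* sin (complex.Im z)).

Section RootSystem.
Context {R : realType} {n : nat}.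
Implicit Types (Phi Phip : {fset 'cV[R]_n}) (k : 'cV[R]_n -> R).

(* The matrix of the reflection x |-> x - 2 <al, x> / <al, al> al. *)
Definition refl_mx (al : 'cV[R]_n) : 'M[R]_n :=
  1%:M - (2 / dot al al) *: (al *m al^T).

(* Neither reducedness nor spanning is required. *)
Definition crystallographic_root_system Phi : Prop :=
  [/\ 0 \notin Phi,
      forall al be, al \in Phi -> be \in Phi -> refl_mx al *m be \in Phi
    & forall al be, al \in Phi -> be \in Phi ->
        2 * dot al be / dot al al \is a Num.int].

Definition positive_subsystem Phi Phip : Prop :=
  exists v : 'cV[R]_n,
    (forall al, al \in Phi -> dot al v != 0) /\
    (forall al, (al \in Phip) = (al \in Phi) && (0 < dot al v)).

(* As reflections are involutions, the monoid they generate is a group. *)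
Inductive in_weyl_group Phi : 'M[R]_n -> Prop :=
| in_weyl_group1 : in_weyl_group Phi 1%:M
| in_weyl_groupM al w : al \in Phi -> in_weyl_group Phi w ->
    in_weyl_group Phi (refl_mx al *m w).

(* fset_set is meaningful only on finite sets; see finite_weyl_group below. *)
Definition weyl_group Phi : {fset 'M[R]_n} :=
  fset_set [set w | in_weyl_group Phi w].

(* Only the values of k on Phi matter. *)
Definition multiplicity_function Phi k : Prop :=
  forall w al, w \in weyl_group Phi -> al \in Phi -> k (w *m al) = k al.

Definition rho Phip k : 'cV[R]_n :=
  2^-1 *: \sum_(al <- Phip) k al *: al.

(* Meaningful at the points t where no denominator vanishes. *)
Definition cherednik Phip k (xi : 'cV[R]_n) (f : 'cV[R[i]]_n -> R[i])
    (t : 'cV[R[i]]_n) : R[i] :=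
  'D_(complexify xi) f t
  + \sum_(al <- Phip) (k al * dot al xi)%:C
      * ((f t - f (complexify (refl_mx al) *m t))
         / (1 - cexp (- dot (complexify al) t)))
  - (dot (rho Phip k) xi)%:C * f t.

Definition regular_point Phip (t : 'cV[R[i]]_n) : Prop :=
  forall al, al \in Phip -> cexp (- dot (complexify al) t) != 1.

Definition tube (Om : set 'cV[R]_n) : set 'cV[R[i]]_n :=
  [set t | Om (map_mx (@complex.Im R) t)].

(* The eigenvalue equations are imposed at the regular points of U = tube Om.
   These are dense in U, and both sides extend holomorphically across the
   removable singularities al = 0 of the Cherednik operators, so this is the
   identity T_xi(k) G = <lam, xi> G on U. *)
Definition cherednik_opdam_kernel Phi Phip k
    (G : 'cV[R[i]]_n -> 'cV[R[i]]_n -> R[i]) : Prop :=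
  exists Om : set 'cV[R]_n,
    [/\ open Om, Om 0
      & forall w y, w \in weyl_group Phi -> Om y -> Om (w *m y)] /\
    [/\ forall lam t, tube Om t ->
          differentiable
            (fun p : 'cV[R[i]]_n * 'cV[R[i]]_n => G p.1 p.2) (lam, t),
        forall (xi : 'cV[R]_n) lam t, tube Om t -> regular_point Phip t ->
          cherednik Phip k xi (G lam) t = dot lam (complexify xi) * G lam t
      & forall lam, G lam 0 = 1].

Definition hypergeometric Phi (G : 'cV[R[i]]_n -> 'cV[R[i]]_n -> R[i])
    (lam t : 'cV[R[i]]_n) : R[i] :=
  (#|` weyl_group Phi|%fset)%:R^-1
  * \sum_(w <- weyl_group Phi) G lam (complexify (invmx w) *m t).

End RootSystem.

Section FiniteWeylGroup.
Context {R : realType} {n : nat}.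
Implicit Types (Phi : {fset 'cV[R]_n}) (w : 'M[R]_n) (x y : 'cV[R]_n).

Lemma dotE x y : dot x y = (x^T *m y) 0 0.
Proof. by rewrite !mxE; apply: eq_bigr => i _; rewrite mxE. Qed.

Lemma dotC x y : dot x y = dot y x.
Proof. by apply: eq_bigr => i _; rewrite mulrC. Qed.

Lemma dotBr x y z : dot x (y - z) = dot x y - dot x z.
Proof. by rewrite -sumrB; apply: eq_bigr => i _; rewrite !mxE mulrBr. Qed.

Lemma dotZr x y c : dot x (c *: y) = c * dot x y.
Proof. by rewrite mulr_sumr; apply: eq_bigr => i _; rewrite !mxE mulrCA. Qed.

Lemma dot_mulmx w x y : dot (w *m x) y = dot x (w^T *m y).
Proof. by rewrite !dotE trmx_mul mulmxA. Qed.

Lemma dotxx_eq0 x : dot x x = 0 -> x = 0.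
Proof.
move=> /eqP; rewrite psumr_eq0 => [/allP h|i _]; last by rewrite -expr2 sqr_ge0.
apply/colP => i; rewrite mxE.
by have := h i (mem_index_enum _); rewrite mulf_eq0 orbb => /eqP.
Qed.

Lemma mulmx_col_inj (A B : 'M[R]_n) :
  (forall x, A *m x = B *m x) -> A = B.
Proof.
move=> AB; apply/matrixP => i j.
by have := AB (delta_mx j 0); rewrite -!colE => /colP /(_ i); rewrite !mxE.
Qed.

Lemma trmx_refl_mx x : (refl_mx x)^T = refl_mx x.
Proof. by rewrite /refl_mx linearB linearZ /= trmx_mul trmxK trmx1. Qed.

Lemma refl_mxE x y : refl_mx x *m y = y - (2 / dot x x * dot x y) *: x.
Proof.
rewrite mulmxBl mul1mx -scalemxAl -mulmxA -scalerA; congr (_ - _ *: _).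
by apply/colP => i; rewrite !mxE big_ord1 dotE mulrC.
Qed.

Lemma refl_mxK x : refl_mx x *m refl_mx x = 1%:M.
Proof.
apply: mulmx_col_inj => y; rewrite -mulmxA mul1mx !refl_mxE.
have [->|x0] := eqVneq x 0; first by rewrite !scaler0 !subr0.
have dx0 : dot x x != 0 by apply: contra_neq x0 => /dotxx_eq0.
set c := 2 / dot x x * dot x y.
have -> : dot x (y - c *: x) = - dot x y.
  by rewrite dotBr dotZr /c; field; exact: dx0.
by rewrite mulrN scaleNr opprK subrK.
Qed.

Lemma in_weyl_group_orthogonal Phi w :
  in_weyl_group Phi w -> w *m w^T = 1%:M.
Proof.
elim=> [|al u _ _ IH]; first by rewrite trmx1 mulmx1.
by rewrite trmx_mul mulmxA -(mulmxA _ u) IH mulmx1 trmx_refl_mx refl_mxK.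
Qed.

Lemma in_weyl_group_stable Phi w al : crystallographic_root_system Phi ->
  in_weyl_group Phi w -> al \in Phi -> w *m al \in Phi /\ w^T *m al \in Phi.
Proof.
move=> [_ stable _] wW; elim: wW al => [|be u bePhi _ IH] al alPhi.
  by rewrite trmx1 mul1mx.
rewrite trmx_mul trmx_refl_mx -!mulmxA; split.
  by apply: stable => //; have [] := IH _ alPhi.
by have [] := IH _ (stable _ _ bePhi alPhi).
Qed.

Lemma in_weyl_group_dot_fix Phi w x z : in_weyl_group Phi w ->
  (forall al, al \in Phi -> dot al z = 0) -> dot (w *m x) z = dot x z.
Proof.
move=> wW z0; elim: wW => [|be u bePhi _ IH]; first by rewrite mul1mx.
by rewrite -mulmxA dot_mulmx trmx_refl_mx refl_mxE z0// mulr0 scale0r subr0.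
Qed.

Lemma in_weyl_group_inj Phi w1 w2 : crystallographic_root_system Phi ->
  in_weyl_group Phi w1 -> in_weyl_group Phi w2 ->
  (forall al, al \in Phi -> w1 *m al = w2 *m al) -> w1 = w2.
Proof.
move=> rsPhi w1W w2W w12; apply: mulmx_col_inj => x; apply/eqP.
rewrite -subr_eq0 -mulmxBl; apply/eqP/dotxx_eq0; set z := _ *m x.
have z0 al : al \in Phi -> dot al z = 0.
  move=> alPhi; have [_ be1] := in_weyl_group_stable rsPhi w1W alPhi.
  have e : w1^T *m al = w2^T *m al.
    rewrite -[w2^T *m al](_ : w2^T *m (w1 *m (w1^T *m al)) = _).
      rewrite w12// mulmxA (mulmx1C (in_weyl_group_orthogonal w2W)).
      by rewrite mul1mx.
    by rewrite [w1 *m _]mulmxA (in_weyl_group_orthogonal w1W) mul1mx.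
  by rewrite dotC dot_mulmx linearB /= mulmxBl e subrr dotE mulmx0 mxE.
rewrite {1}/z mulmxBl dotC dotBr ![dot z _]dotC.
by rewrite !(in_weyl_group_dot_fix _ _ z0)// subrr.
Qed.

Lemma finite_weyl_group Phi : crystallographic_root_system Phi ->
  finite_set [set w | in_weyl_group Phi w].
Proof.
move=> rsPhi.
pose f w := [ffun a : Phi => insubd a (w *m val a)].
have finj : {in [set w | in_weyl_group Phi w] &, injective f}.
  move=> w1 w2 /set_mem/= w1W /set_mem/= w2W f12.
  apply: (in_weyl_group_inj rsPhi w1W w2W) => al alPhi.
  have := congr1 (fun g : {ffun Phi -> Phi} => val (g [` alPhi]%fset)) f12.
  rewrite !ffunE !val_insubd /=.
  by have [-> _] := in_weyl_group_stable rsPhi w1W alPhi;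
     have [-> _] := in_weyl_group_stable rsPhi w2W alPhi.
rewrite -(eq_finite_set (inj_card_eq finj)); exact: finite_finset.
Qed.

Lemma in_weyl_groupP Phi w : crystallographic_root_system Phi ->
  w \in weyl_group Phi <-> in_weyl_group Phi w.
Proof.
move=> rsPhi; rewrite in_fset_set; last exact: finite_weyl_group.
by split=> [/set_mem//|wW]; apply/mem_set.
Qed.

End FiniteWeylGroup.

(* Main.v *)
(* Since T_xi 1 = - <rho, xi>, an eigenfunction f of the Cherednik operators
   with spectral parameter lam - rho satisfies a first order system in which
   only <lam, xi> and the reflection terms appear.  As u / (1 - e^(-u)) > 0,
   along a ray the reflection terms decrease |f| at a point where |f| is maximal
   on its W-orbit, so a maximum principle gives
   |f(t)| <= |f(0)| exp(max_w Re <w lam, t>).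
   This bounds G(lam - rho; t); applied with f(0) = 0 it also shows that an
   eigenfunction is determined on the real space by its value at 0.  For a
   simple root al with reflection s, G(lam; s t) + c G(lam; t) is an
   eigenfunction with parameter s lam for a suitable constant c, hence a
   multiple of G(s lam; t), and averaging over W gives F_(s lam) = F_lam.  Finally the
   longest element w0 of W sends rho to - rho, so
   F_(lam + rho) = F_(w0 lam - rho). *)
Require Import Defs.
From mathcomp Require Import all_boot all_order all_algebra finmap.
From mathcomp Require Import all_classical all_reals all_analysis.
From mathcomp Require Import complex.
From mathcomp Require Import ring lra zify.
Import numFieldNormedType.Exports.

Set Implicit Arguments.
Unset Strict Implicit.
Unset Printing Implicit Defensive.

Import Order.TTheory GRing.Theory Num.Theory.

Local Open Scope classical_set_scope.
Local Open Scope ring_scope.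
Local Open Scope complex_scope.

(** * Extrema and permutations on finite sets *)

Lemma seq_arg_min (T : eqType) d (U : orderType d) (f : T -> U) (s : seq T) x :
  x \in s -> exists2 y, y \in s & forall z, z \in s -> (f y <= f z)%O.
Proof.
elim: s x => // a s IH x _; case: s IH => [_|b s IH].
  by exists a; rewrite ?mem_head// => z; rewrite inE => /eqP->.
have [y ys ymin] := IH b (mem_head _ _).
have [ay|/ltW ya] := leP (f a) (f y).
  exists a; rewrite ?mem_head// => z; rewrite inE => /predU1P[->//|/ymin].
  exact: le_trans.
by exists y; [rewrite inE ys orbT|move=> z; rewrite inE => /predU1P[->|/ymin]].
Qed.

Lemma perm_map_fset (T : choiceType) (A : {fset T}) (f : T -> T) :
  {in A &, injective f} -> (forall x, x \in A -> f x \in A) ->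
  perm_eq (map f A) A.
Proof.
move=> finj fA; have fu : uniq (map f A) by rewrite map_inj_in_uniq ?fset_uniq.
have sub : {subset map f A <= A} by move=> _ /mapP[y /fA fyA ->].
have le_size : (size A <= size (map f A))%N by rewrite size_map.
by apply: uniq_perm => //; have [] := uniq_min_size fu sub le_size.
Qed.

(** * The bilinear form over a commutative ring *)

Section Dot.
Context {K : comPzRingType} {n : nat}.
Implicit Types (x y z : 'cV[K]_n) (c : K).

Lemma dotDl x y z : dot (x + y) z = dot x z + dot y z.
Proof. by rewrite -big_split; apply: eq_bigr => i _; rewrite mxE mulrDl. Qed.

Lemma dotZl c x y : dot (c *: x) y = c * dot x y.
Proof. by rewrite mulr_sumr; apply: eq_bigr => i _; rewrite mxE mulrA. Qed.

Lemma dotNl x y : dot (- x) y = - dot x y.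
Proof. by rewrite -scaleN1r dotZl mulN1r. Qed.

Lemma dotBl x y z : dot (x - y) z = dot x z - dot y z.
Proof. by rewrite dotDl dotNl. Qed.

Lemma dot_comm x y : dot x y = dot y x.
Proof. by apply: eq_bigr => i _; rewrite mulrC. Qed.

Lemma dotDr x y z : dot x (y + z) = dot x y + dot x z.
Proof. by rewrite !(dot_comm x) dotDl. Qed.

Lemma dot_scaler c x y : dot x (c *: y) = c * dot x y.
Proof. by rewrite !(dot_comm x) dotZl. Qed.

Lemma dot_suml (I : Type) (r : seq I) (P : pred I) (F : I -> 'cV[K]_n) z :
  dot (\sum_(i <- r | P i) F i) z = \sum_(i <- r | P i) dot (F i) z.
Proof.
elim/big_rec2: _ => [|i a b _ <-]; last by rewrite dotDl.
by rewrite /dot big1// => i _; rewrite mxE mul0r.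
Qed.

Lemma dot_mulmxl (A : 'M[K]_n) x y : dot (A *m x) y = dot x (A^T *m y).
Proof.
have dE u v : dot u v = (u^T *m v) 0 0.
  by rewrite !mxE; apply: eq_bigr => i _; rewrite mxE.
by rewrite !dE trmx_mul mulmxA.
Qed.

End Dot.

(** * Positive systems, simple roots and the longest element *)

Section Roots.
Context {R : realType} {n : nat}.
Implicit Types (Phi Phip : {fset 'cV[R]_n}) (al be : 'cV[R]_n) (w : 'M[R]_n).

Lemma dotxx_gt0 al : al != 0 -> 0 < dot al al.
Proof.
move=> al0; rewrite lt_def (contra_neq (@dotxx_eq0 _ _ al))//=.
by apply: sumr_ge0 => i _; rewrite -expr2 sqr_ge0.
Qed.

Lemma in_weyl_groupMM Phi w1 w2 :
  in_weyl_group Phi w1 -> in_weyl_group Phi w2 -> in_weyl_group Phi (w1 *m w2).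
Proof.
move=> + w2W; elim=> [|al u alPhi _ IH]; first by rewrite mul1mx.
by rewrite -mulmxA; constructor.
Qed.

Lemma in_weyl_group_refl Phi al : al \in Phi -> in_weyl_group Phi (refl_mx al).
Proof. by move=> alPhi; rewrite -[refl_mx al]mulmx1; do 2?constructor. Qed.

Lemma in_weyl_group_tr Phi w : in_weyl_group Phi w -> in_weyl_group Phi w^T.
Proof.
elim=> [|al u alPhi _ IH]; first by rewrite trmx1; constructor.
rewrite trmx_mul trmx_refl_mx; apply: in_weyl_groupMM IH _.
exact: in_weyl_group_refl.
Qed.

Lemma in_weyl_group_invmx Phi w : in_weyl_group Phi w -> invmx w = w^T.
Proof.
move=> /in_weyl_group_orthogonal wwT; have [wu _] := mulmx1_unit wwT.
by rewrite -[RHS](mulKmx wu) wwT mulmx1.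
Qed.

Lemma refl_mxZ (c : R) al : c != 0 -> refl_mx (c *: al) = refl_mx al.
Proof.
move=> c0; have [->|al0] := eqVneq al 0; first by rewrite scaler0.
rewrite /refl_mx dotZl dotZr [(c *: al)^T]linearZ/=.
rewrite -scalemxAl -scalemxAr !scalerA.
by congr (_ - _ *: _); field; rewrite gt_eqF ?dotxx_gt0.
Qed.

Lemma refl_mxN al : al != 0 -> refl_mx al *m al = - al.
Proof.
move=> al0; rewrite refl_mxE divfK ?gt_eqF ?dotxx_gt0//.
by rewrite scaler_nat mulr2n opprD addrA subrr add0r.
Qed.

Lemma root_neq0 Phi al : crystallographic_root_system Phi ->
  al \in Phi -> al != 0.
Proof. by move=> [Phi0 _ _]; apply: contraTneq => ->. Qed.

Lemma root_opp Phi al : crystallographic_root_system Phi ->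
  al \in Phi -> - al \in Phi.
Proof.
move=> rsPhi alPhi; rewrite -refl_mxN ?(root_neq0 rsPhi)//.
by case: rsPhi => _ stable _; exact: stable.
Qed.

(** Strict Cauchy-Schwarz puts the product of the two Cartan integers below 4. Both are positive, so
    one of them is 1, and the corresponding reflection yields [be - al] or its opposite. *)
Lemma root_sub Phi al be : crystallographic_root_system Phi ->
  al \in Phi -> be \in Phi -> (forall c, be != c *: al) -> 0 < dot al be ->
  be - al \in Phi.
Proof.
move=> rsPhi alPhi bePhi nprop ab0.
have aa0 := dotxx_gt0 (root_neq0 rsPhi alPhi).
have bb0 := dotxx_gt0 (root_neq0 rsPhi bePhi).
have CS : dot al be ^+ 2 < dot al al * dot be be.
  have /dotxx_gt0 : dot al al *: be - dot al be *: al != 0.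
    rewrite subr_eq0; apply/negP => /eqP /(congr1 ( *:%R (dot al al)^-1)).
    rewrite !scalerA mulVf ?gt_eqF// scale1r => bE.
    by have := nprop ((dot al al)^-1 * dot al be); rewrite {1}bE eqxx.
  rewrite dotBl !dotBr !dotZl !dotZr (dotC be al).
  rewrite (_ : _ - _ = dot al al * (dot al al * dot be be - dot al be ^+ 2)).
    by rewrite pmulr_rgt0// subr_gt0.
  by ring.
have [_ stable intr] := rsPhi.
have /intrP[a aE] := intr _ _ alPhi bePhi.
have /intrP[b bE] := intr _ _ bePhi alPhi.
have a0 : (0 < a)%R by rewrite -(ltr0z R) -aE divr_gt0// mulr_gt0.
have b0 : (0 < b)%R by rewrite -(ltr0z R) -bE divr_gt0// mulr_gt0// dotC.
have ab4 : (a * b < 4)%R.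
  rewrite -(ltr_int R) rmorphM/= -aE -bE (dotC be al) [ltRHS](_ : _ = 4)//.
  rewrite [ltLHS](_ : _ = 4 * (dot al be ^+ 2 / (dot al al * dot be be))).
    by rewrite -[ltRHS]mulr1 ltr_pM2l// ltr_pdivrMr ?mul1r// mulr_gt0.
  by field; rewrite !gt_eqF.
have [a1|b1] : a = 1 \/ b = 1 by nia.
  have := stable _ _ alPhi bePhi.
  by rewrite refl_mxE mulrAC aE a1 scale1r.
have := stable _ _ bePhi alPhi.
rewrite refl_mxE mulrAC bE b1 scale1r => /(root_opp rsPhi).
by rewrite opprB.
Qed.

Definition indecomposable Phip al : Prop :=
  al \in Phip /\ forall be ga, be \in Phip -> ga \in Phip -> al != be + ga.

(** Only this permutation property of simple roots is used for the operators. As the system may be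
    non-reduced, proportional roots are set apart; twice a simple root, if it is a root, satisfies
    the definition too. *)
Definition simple_root Phip al : Prop :=
  al \in Phip /\ forall be, be \in Phip ->
    refl_mx al *m be \in Phip \/ exists c, be = c *: al.

Lemma opp_positive_root Phi Phip v al : crystallographic_root_system Phi ->
  (forall al, al \in Phi -> dot al v != 0) ->
  (forall al, (al \in Phip) = (al \in Phi) && (0 < dot al v)) ->
  al \in Phi -> al \notin Phip -> - al \in Phip.
Proof.
move=> rsPhi v0 PhipE alPhi; rewrite !PhipE alPhi/= => nal.
by rewrite root_opp// dotNl oppr_gt0 lt_def eq_sym v0// leNgt.
Qed.

(** Otherwise [al - be] would be positive and [al = be + (al - be)] would decompose [al]. *)
Lemma indecomposable_sub Phi Phip al be : crystallographic_root_system Phi ->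
  positive_subsystem Phi Phip -> indecomposable Phip al -> be \in Phip ->
  (forall c, be != c *: al) -> 0 < dot al be -> be - al \in Phip.
Proof.
move=> rsPhi [v [v0 PhipE]] [alp indec] bep nprop ab0.
have [/andP[alPhi _] /andP[bePhi _]] : (al \in Phi) && (0 < dot al v) /\
  (be \in Phi) && (0 < dot be v) by rewrite -!PhipE.
have subPhi := root_sub rsPhi alPhi bePhi nprop ab0.
apply: contraT => /(opp_positive_root rsPhi v0 PhipE subPhi).
by rewrite opprB => /(indec _ _ bep); rewrite subrKC eqxx.
Qed.

(** Each subtraction of [al] lowers the Cartan integer [m] by 2. The bound on [j] keeps it positive
    before every subtraction, so [indecomposable_sub] applies each time. *)
Lemma indecomposable_string Phi Phip al be (m : int) (j : nat) :
  crystallographic_root_system Phi -> positive_subsystem Phi Phip ->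
  indecomposable Phip al -> be \in Phip -> (forall c, be != c *: al) ->
  2 * dot al be / dot al al = m%:~R -> ((2 * j)%:Z <= m + 1)%R ->
  be - j%:R *: al \in Phip.
Proof.
move=> rsPhi psPhi indec bep nprop mE.
have aa0 : 0 < dot al al.
  apply/dotxx_gt0/(root_neq0 rsPhi).
  by case: psPhi indec => v [_ PhipE] [+ _]; rewrite PhipE => /andP[].
elim: j => [|j IH] jm; first by rewrite scale0r subr0.
rewrite -natr1 scalerDl scale1r opprD addrA.
apply: (indecomposable_sub rsPhi psPhi indec).
- by apply: IH; lia.
- by move=> c; rewrite subr_eq -scalerDl.
have -> : dot al (be - j%:R *: al) = (m%:~R - (2 * j)%:R) * (dot al al / 2).
  by rewrite -mE dotBr dotZr natrM; field; rewrite gt_eqF.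
by rewrite pmulr_lgt0 ?divr_gt0// subr_gt0 pmulrn ltr_int; lia.
Qed.

(** Suppose that the reflected root [be - m al] is negative. Then [m al - be] is positive with the
    same Cartan integer [m]. Descending by [j al], with [2 j >= m], from both [be] and [m al - be]
    gives two positive roots with sum [(m - 2 j) al], which is not positive on [v]. *)
Lemma indecomposable_simple Phi Phip al : crystallographic_root_system Phi ->
  positive_subsystem Phi Phip -> indecomposable Phip al -> simple_root Phip al.
Proof.
move=> rsPhi psPhi indec; have [alp _] := indec; split=> // be bep.
have [[c bE]|nprop] := pselect (exists c, be = c *: al).
  by right; exists c.
left.
have {}nprop c : be != c *: al by apply/eqP => bE; apply: nprop; exists c.
have [v [v0 PhipE]] := psPhi.
have /andP[alPhi av0] : (al \in Phi) && (0 < dot al v) by rewrite -PhipE.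
have /andP[bePhi bv0] : (be \in Phi) && (0 < dot be v) by rewrite -PhipE.
have aa0 := dotxx_gt0 (root_neq0 rsPhi alPhi).
have [_ stable intr] := rsPhi.
have /intrP[m mE] := intr _ _ alPhi bePhi.
have sE : refl_mx al *m be = be - m%:~R *: al by rewrite refl_mxE mulrAC mE.
have sPhi := stable _ _ alPhi bePhi.
have [m0|m0] := lerP m 0.
  rewrite PhipE sPhi sE dotBl dotZl subr_gt0 (le_lt_trans _ bv0)//.
  by rewrite pmulr_lle0// lerz0.
apply: contraT => /(opp_positive_root rsPhi v0 PhipE sPhi) gap.
have gprop c : - (refl_mx al *m be) != c *: al.
  rewrite sE opprB subr_eq addrC -subr_eq -scalerBl eq_sym; exact: nprop.
have gE : 2 * dot al (- (refl_mx al *m be)) / dot al al = m%:~R.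
  by rewrite sE opprB dotBr dotZr -mE; field; rewrite gt_eqF.
(* Half of [m] rounded up is the longest descent that [indecomposable_string] allows. *)
have [j jm mj] : exists2 j : nat, ((2 * j)%:Z <= m + 1)%R & (m <= (2 * j)%:Z)%R.
  by exists (`|m|.+1 %/ 2)%N; clear -m0; lia.
have := indecomposable_string rsPhi psPhi indec bep nprop mE jm.
rewrite PhipE => /andP[_]; rewrite dotBl dotZl => h1.
have := indecomposable_string rsPhi psPhi indec gap gprop gE jm.
rewrite PhipE => /andP[_]; rewrite sE opprB !dotBl !dotZl => h2.
have h3 : m%:~R <= (2 * j)%:R :> R by rewrite [leRHS]pmulrn ler_int.
have := ler_wpM2r (ltW av0) h3; rewrite natrM; lra.
Qed.

(** Among the positive roots negative on [x], take one that is lowest with respect to [v]. If it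
    were a sum of two positive roots, one summand would be negative on [x] and lower still. *)
Lemma simple_root_lt0 Phi Phip be x : crystallographic_root_system Phi ->
  positive_subsystem Phi Phip -> be \in Phip -> dot be x < 0 ->
  exists2 al, simple_root Phip al & dot al x < 0.
Proof.
move=> rsPhi psPhi bep bx0; have [v [_ PhipE]] := psPhi.
have bes : be \in [seq be <- Phip | dot be x < 0] by rewrite mem_filter bx0.
have [al + almin] := seq_arg_min (dot^~ v) bes.
rewrite mem_filter => /andP[ax0 alp]; exists al => //.
apply: (indecomposable_simple rsPhi psPhi); split=> // b1 b2 b1p b2p.
apply/negP => /eqP alE.
have := b1p; have := b2p; rewrite !PhipE => /andP[_ v2] /andP[_ v1].
have [b1x|b1x] := ltrP (dot b1 x) 0.
  by have := almin b1; rewrite mem_filter b1x b1p alE dotDl => /(_ isT); lra.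
have [b2x|b2x] := ltrP (dot b2 x) 0.
  by have := almin b2; rewrite mem_filter b2x b2p alE dotDl => /(_ isT); lra.
by move: ax0; rewrite alE dotDl; lra.
Qed.

(* The element of W maximizing dot (w (- v)) v among those with property P
   brings - v into the positive chamber. *)
Lemma longest_element Phi Phip (P : 'M[R]_n -> Prop) :
  crystallographic_root_system Phi -> positive_subsystem Phi Phip ->
  P 1%:M -> (forall al w, simple_root Phip al -> P w -> P (refl_mx al *m w)) ->
  exists w, [/\ in_weyl_group Phi w, P w &
    forall al, al \in Phip -> - (w^T *m al) \in Phip].
Proof.
move=> rsPhi psPhi P1 PM; have [v [v0 PhipE]] := psPhi.
have s1 : 1%:M \in [seq w <- weyl_group Phi | `[<P w>]].
  rewrite mem_filter; apply/andP; split; first exact/asboolP.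
  by apply/in_weyl_groupP => //; constructor.
have [w + wmin] := seq_arg_min (fun w => dot (w *m v) v) s1.
rewrite mem_filter => /andP[/asboolP Pw /(in_weyl_groupP _ rsPhi) wW].
exists w; split=> // al alp.
have alPhi : al \in Phi by move: alp; rewrite PhipE => /andP[].
have [_ walPhi] := in_weyl_group_stable rsPhi wW alPhi.
rewrite PhipE root_opp//= dotNl oppr_gt0 lt_def eq_sym v0//=.
rewrite dot_mulmxl trmxK leNgt; apply/negP => al0.
(* If [al] is positive on [w v], so is some simple [be]; reflecting in [be] then preserves [P] and
   lowers [dot (w v) v] below its minimum. *)
have [be sbe] : exists2 be, simple_root Phip be & dot be (- (w *m v)) < 0.
  by apply: (simple_root_lt0 rsPhi psPhi alp); rewrite dotC dotNl dotC oppr_lt0.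
rewrite dotC dotNl oppr_lt0 dotC => wv0.
have /andP[bePhi bv0] : (be \in Phi) && (0 < dot be v).
  by rewrite -PhipE; case: sbe.
have := wmin (refl_mx be *m w); rewrite mem_filter.
have -> : refl_mx be *m w \in weyl_group Phi.
  by apply/in_weyl_groupP => //; constructor.
rewrite (asboolT (PM _ _ sbe Pw)) => /(_ isT).
rewrite -mulmxA refl_mxE dotBl dotZl leNgt gtrBl => /negP; apply.
by rewrite !mulr_gt0// invr_gt0 dotxx_gt0// (root_neq0 rsPhi).
Qed.

End Roots.

(** * Derivatives along real lines *)

Section Line.
Context {R : realType} {n : nat}.
Implicit Types (f : 'cV[R[i]]_n -> R[i]) (x v : 'cV[R]_n).

Lemma complexifyDZ x v (s : R) :
  complexify (x + s *: v) = complexify x + s%:C *: complexify v.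
Proof. by rewrite /complexify map_mxD map_mxZ. Qed.

(** [L] stands for the real or the imaginary part. Being real-linear and norm-decreasing, it carries
    the limit of the complex difference quotients, taken at real increments, to the limit of the
    real ones. *)
Lemma is_derive_line (L : R[i] -> R) f x v s :
  (forall a b, L (a - b) = L a - L b) ->
  (forall (r : R) a, L (r%:C * a) = r * L a) ->
  (forall a, `|L a|%:C <= `|a|) ->
  derivable f (complexify (x + s *: v)) (complexify v) ->
  is_derive s 1 (fun r : R => L (f (complexify (x + r *: v))))
    (L ('D_(complexify v) f (complexify (x + s *: v)))).
Proof.
move=> LB LM Lle df; set p := complexify (x + s *: v).
have lim : (fun h : R => h^-1 *: (L (f (complexify (x + (h *: 1 + s) *: v))) -
    L (f (complexify (x + s *: v))))) @ 0^' --> L ('D_(complexify v) f p).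
  apply/cvgrPdist_lt => e e0.
  have /cvgrPdist_lt /(_ e%:C) : (fun h => h^-1 *:
    ((f \o shift p) (h *: complexify v) - f p)) @ 0^' --> 'D_(complexify v) f p.
    exact: df.
  rewrite ltcR => /(_ e0) /nbhs_ballP[d /= d0 dP].
  (* Positivity in [R[i]] forces [d] to be real, so its real part serves as a real radius. *)
  have dRe : 0 < complex.Re d by move: d0; rewrite ltcE => /andP[].
  apply/nbhs_ballP; exists (complex.Re d) => //= h hd h0.
  have hC : (h%:C : R[i]) != 0 by rewrite fmorph_eq0.
  have := dP h%:C; rewrite -ball_normE/= sub0r normrN.
  have -> : `|(h%:C : R[i])| < d.
    move: hd; rewrite -ball_normE/= sub0r normrN -ltcR => hd.
    rewrite normc_def/= expr0n addr0 sqrtr_sqr (lt_le_trans hd)//.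
    by rewrite lecE/= lexx andbT; move: d0; rewrite ltcE => /andP[].
  move=> /(_ isT hC).
  rewrite scaler1 [h + s]addrC scalerDl addrA.
  rewrite [complexify (_ + h *: v)]complexifyDZ -/p [p + _]addrC.
  move=> lt_e; rewrite -ltcR (le_lt_trans _ lt_e)//.
  by rewrite (le_trans _ (Lle _))// LB -fmorphV LM LB.
by split; [apply/cvg_ex; exists (L ('D_(complexify v) f p)) | apply: cvg_lim].
Qed.

Lemma is_derive_Re f x v s :
  derivable f (complexify (x + s *: v)) (complexify v) ->
  is_derive s 1 (fun r : R => complex.Re (f (complexify (x + r *: v))))
    (complex.Re ('D_(complexify v) f (complexify (x + s *: v)))).
Proof.
apply: is_derive_line => [[? ?] [? ?]//|r [? ?]/=|[a b]].
  by rewrite mul0r subr0.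
exact: normc_ge_Re.
Qed.

Lemma is_derive_Im f x v s :
  derivable f (complexify (x + s *: v)) (complexify v) ->
  is_derive s 1 (fun r : R => complex.Im (f (complexify (x + r *: v))))
    (complex.Im ('D_(complexify v) f (complexify (x + s *: v)))).
Proof.
apply: is_derive_line => [[? ?] [? ?]//|r [? ?]/=|[a b]].
  by rewrite mul0r addr0.
by rewrite normc_def lecR -sqrtr_sqr ler_wsqrtr//= lerDr sqr_ge0.
Qed.

(** The maximum may sit at the right end of the interval, so only left difference quotients are
    available and the derivative need not vanish. *)
Lemma derive_at_max (u : R -> R) (a s d : R) : a < s -> is_derive s 1 u d ->
  (forall r, a <= r <= s -> u r <= u s) -> 0 <= d.
Proof.
move=> a_s du umax; rewrite leNgt; apply/negP => d0.
have /cvgrPdist_lt /(_ (- d)) :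
    (fun h => h^-1 *: ((u \o shift s) (h *: 1) - u s)) @ 0^' --> d.
  by rewrite -(@derive_val _ _ _ _ _ _ _ du); exact: ex_derive.
rewrite oppr_gt0 => /(_ d0) /nbhs_ballP[e /= e0 eP].
(* A step to the left, strictly inside the ball of radius [e] and not passing [a]. *)
pose h := - Num.min (e / 2) (s - a).
have h0 : h < 0 by rewrite oppr_lt0 lt_min divr_gt0//= subr_gt0.
have he : - h <= e / 2 by rewrite opprK ge_min lexx.
have ha : - h <= s - a by rewrite opprK ge_min lexx orbT.
have := eP h; rewrite -ball_normE/= sub0r normrN ltr0_norm// => /(_ _)/wrap[].
  by rewrite (le_lt_trans he)// ltr_pdivrMr// mulr_natr mulr2n ltrDl.
rewrite lt_eqF// => /(_ isT); rewrite ltr_distl => /andP[+ _].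
rewrite scaler1 opprK gtrDr/=; apply/negP; rewrite -leNgt.
by rewrite nmulr_rge0 ?invr_lt0// subr_le0 umax//; lra.
Qed.

End Line.

(** * The maximum principle for Cherednik eigenfunctions *)

Section Eigenfunctions.
Context {R : realType} {n : nat}.
Implicit Types (Phi Phip : {fset 'cV[R]_n}) (k : 'cV[R]_n -> R).
Implicit Types (f : 'cV[R[i]]_n -> R[i]) (x v al : 'cV[R]_n) (w : 'M[R]_n).

Lemma dot_complexify x v : dot (complexify x) (complexify v) = (dot x v)%:C.
Proof.
by rewrite rmorph_sum/=; apply: eq_bigr => i _; rewrite !mxE rmorphM.
Qed.

Lemma complexify_mulmx m w (A : 'M[R]_(n, m)) :
  complexify (w *m A) = complexify w *m complexify A.
Proof. exact: map_mxM. Qed.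

Lemma complexify0 : complexify (0 : 'cV[R]_n) = 0.
Proof. exact: map_mx0. Qed.

Lemma cexp_real (r : R) : cexp r%:C = (expR r)%:C.
Proof. by rewrite /cexp/= cos0 sin0 mulr1. Qed.

Lemma regular_point_complexify Phip x :
  regular_point Phip (complexify x) <-> forall al, al \in Phip -> dot al x != 0.
Proof.
have E al :
    (cexp (- dot (complexify al) (complexify x)) != 1) = (dot al x != 0).
  rewrite dot_complexify -rmorphN cexp_real fmorph_eq1.
  by rewrite -expR0 (inj_eq (@expR_inj _)) oppr_eq0.
by split=> h al /h; rewrite E.
Qed.

(* Only directional derivatives along a, at points of a, are used. *)
Definition cherednik_eigenfunction Phip k (mu : 'cV[R[i]]_n) f : Prop :=
  (forall x v, derivable f (complexify x) (complexify v)) /\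
  forall xi x, regular_point Phip (complexify x) ->
    cherednik Phip k xi f (complexify x)
    = dot mu (complexify xi) * f (complexify x).

(** The Euclidean inner product of the plane, the real part of [conj a * b]. It makes the squared
    modulus differentiable without square roots. *)
Definition cdot2 (a b : R[i]) : R :=
  complex.Re a * complex.Re b + complex.Im a * complex.Im b.

Local Notation csqr a := (cdot2 a a).

Lemma cdot2D a b c : cdot2 a (b + c) = cdot2 a b + cdot2 a c.
Proof. by case: a b c => [? ?] [? ?] [? ?]; rewrite /cdot2/=; ring. Qed.

Lemma cdot2B a b c : cdot2 a (b - c) = cdot2 a b - cdot2 a c.
Proof. by case: a b c => [? ?] [? ?] [? ?]; rewrite /cdot2/=; ring. Qed.

Lemma cdot2_sum a (I : Type) (r : seq I) (F : I -> R[i]) :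
  cdot2 a (\sum_(i <- r) F i) = \sum_(i <- r) cdot2 a (F i).
Proof.
elim/big_rec2: _ => [|i _ c _ <-]; last by rewrite cdot2D.
by case: a => ? ?; rewrite /cdot2/= !mulr0 addr0.
Qed.

Lemma cdot2Zr a (r : R) b : cdot2 a (r%:C * b) = r * cdot2 a b.
Proof. by case: a b => [? ?] [? ?]; rewrite /cdot2/=; ring. Qed.

Lemma cdot2_self a c : cdot2 a (c * a) = complex.Re c * csqr a.
Proof. by case: a c => [? ?] [? ?]; rewrite /cdot2/=; ring. Qed.

Lemma cdot2_ge0 a : 0 <= csqr a.
Proof. by case: a => ? ?; rewrite /cdot2/= -!expr2 addr_ge0 ?sqr_ge0. Qed.

Lemma sqr_normc_cdot2 a : `|a| ^+ 2 = (csqr a)%:C.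
Proof.
by rewrite normc_def -rmorphXn/= sqr_sqrtr// addr_ge0 ?sqr_ge0.
Qed.

Lemma cdot2_le a b : csqr b <= csqr a -> cdot2 a b <= csqr a.
Proof.
case: a b => [a1 a2] [b1 b2]; rewrite /cdot2/= => h.
have := sqr_ge0 (a1 - b1); have := sqr_ge0 (a2 - b2).
by rewrite !expr2; nra.
Qed.

(** Numerator and denominator share the sign of [u]. The factor [s] appears because a root is paired
    with the direction [x] but exponentiated at the point [s x]. *)
Lemma ge0_div_1subexp (s u : R) : 0 < s -> 0 <= u / (1 - expR (- (s * u))).
Proof.
move=> s0; have [u0|u0|->] := ltrgt0P u; last by rewrite mul0r.
  rewrite divr_ge0 ?ltW// subr_gt0 -expR0 ltr_expR oppr_lt0 mulr_gt0//.
rewrite -mulrNN -invrN divr_ge0// ?oppr_ge0 ?ltW//.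
by rewrite subr_lt0 -expR0 ltr_expR oppr_gt0 nmulr_llt0.
Qed.

(** Take [xi = x] in the eigenvalue equation at [s x]: the shift by [rho] cancels the [rho] term of
    the operator. Each reflection term has a nonnegative coefficient and, as [|f|] does not grow
    under reflection, a difference with nonnegative inner product with [f]; dropping these terms
    gives the inequality. *)
Lemma eigenfunction_growth Phip k lam f x s :
  (forall al, al \in Phip -> 0 <= k al) ->
  cherednik_eigenfunction Phip k (lam - complexify (rho Phip k)) f ->
  0 < s -> (forall al, al \in Phip -> dot al x != 0) ->
  let p := s *: x in
  (forall al, al \in Phip ->
    csqr (f (complexify (refl_mx al *m p))) <= csqr (f (complexify p))) ->
  cdot2 (f (complexify p)) ('D_(complexify x) f (complexify p)) <=
  complex.Re (dot lam (complexify x)) * csqr (f (complexify p)).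
Proof.
move=> k0 [_ feq] s0 xreg p fmax.
have preg : regular_point Phip (complexify p).
  apply/regular_point_complexify => al /xreg.
  by rewrite dotZr mulf_eq0 (gt_eqF s0).
have := feq x p preg; rewrite /cherednik dotBl dot_complexify mulrBl.
move=> /addIr /(canRL (addrK _)) ->; rewrite cdot2B cdot2_self gerBl.
rewrite cdot2_sum big_seq sumr_ge0// => al alp.
rewrite dot_complexify -rmorphN cexp_real -complexify_mulmx.
rewrite [X in cdot2 _ X](_ : _ =
  (k al * (dot al x / (1 - expR (- dot al p))))%:C *
  (f (complexify p) - f (complexify (refl_mx al *m p)))).
  rewrite cdot2Zr mulr_ge0//; last by rewrite cdot2B subr_ge0 cdot2_le ?fmax.
  by rewrite mulr_ge0 ?k0// /p dotZr ge0_div_1subexp.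
by rewrite !rmorphM/= fmorphV rmorphB/= rmorph1; ring.
Qed.

Lemma derivable_line_continuous f x v : (forall s : R,
    derivable f (complexify (x + s *: v)) (complexify v)) ->
  continuous (fun s : R => csqr (f (complexify (x + s *: v)))).
Proof.
move=> df s; have dRe := is_derive_Re (df s); have dIm := is_derive_Im (df s).
have /derivable1_diffP/differentiable_continuous cRe :=
  @ex_derive _ _ _ _ _ _ _ dRe.
have /derivable1_diffP/differentiable_continuous cIm :=
  @ex_derive _ _ _ _ _ _ _ dIm.
by apply: cvgD; apply: cvgM.
Qed.

Lemma is_derive_weighted f x (c s : R) :
  derivable f (complexify (s *: x)) (complexify x) ->
  is_derive s 1
    (fun r : R => expR (c * r) * csqr (f (complexify (r *: x))))
    (expR (c * s) * (c * csqr (f (complexify (s *: x))) +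
      2 * cdot2 (f (complexify (s *: x)))
        ('D_(complexify x) f (complexify (s *: x))))).
Proof.
rewrite -[s *: x]add0r => df.
have dRe := is_derive_Re df; have dIm := is_derive_Im df.
rewrite (_ : (fun r : R => _) = (fun r : R => expR (c * r) *
   csqr (f (complexify (0 + r *: x))))); last first.
  by apply/funext => r; rewrite add0r.
move: ('D_(complexify x) f _) dRe dIm => D dRe dIm.
rewrite /cdot2; apply: is_derive_eq.
rewrite /GRing.scale/= !mulr1.
by ring.
Qed.

(* Maximum principle for exp(-2 s b) |f(s w x)|^2 over s in [0,1] and w in W:
   at a maximum with s > 0 the reflection terms have the good sign. *)
Lemma eigenfunction_bound_regular Phi Phip k lam f x b :
  crystallographic_root_system Phi -> positive_subsystem Phi Phip ->
  (forall al, al \in Phi -> 0 <= k al) ->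
  cherednik_eigenfunction Phip k (lam - complexify (rho Phip k)) f ->
  (forall al, al \in Phi -> dot al x != 0) ->
  (forall w, in_weyl_group Phi w ->
    complex.Re (dot lam (complexify (w *m x))) < b) ->
  csqr (f (complexify x)) <=
  csqr (f 0) * expR (2 * b).
Proof.
move=> rsPhi psPhi k0 eigf xreg lamb; have [df _] := eigf.
have [v [_ PhipE]] := psPhi.
have PhipS al : al \in Phip -> al \in Phi by rewrite PhipE => /andP[].
pose u (w : 'M[R]_n) (s : R) := expR (- (2 * b) * s) *
  csqr (f (complexify (s *: (w *m x)))).
have du (w : 'M[R]_n) (s : R) : is_derive s 1 (u w) _ :=
  is_derive_weighted (- (2 * b)) (df (s *: (w *m x)) (w *m x)).
have umax w : exists c,
    c \in `[0, 1] /\ forall t, t \in `[0, 1] -> u w t <= u w c.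
  have cu : {within `[0, 1], continuous (u w)}.
    apply: continuous_subspaceT => s; apply: differentiable_continuous.
    by apply/derivable1_diffP; exact: ex_derive.
  by have [c c01 cmax] := EVT_max ler01 cu; exists c.
have [S SP] := choice umax.
have W1 : in_weyl_group Phi 1%:M by constructor.
(* Minimizing the negative selects the group element with the largest of the maxima over
   [[0, 1]]. *)
have [w /(in_weyl_groupP _ rsPhi) wW wmax] :=
  seq_arg_min (fun w => - u w (S w)) ((in_weyl_groupP _ rsPhi).2 W1).
have {}wmax w' t : in_weyl_group Phi w' -> 0 <= t <= 1 -> u w' t <= u w (S w).
  move=> w'W t01; have [_ cmax] := SP w'.
  rewrite (le_trans (cmax t _)) ?in_itv//= -lerN2 wmax//.
  exact/in_weyl_groupP.
have F0 : 0 <= csqr (f 0) by exact: cdot2_ge0.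
suff uS : u w (S w) <= csqr (f 0).
  have := wmax 1%:M 1 W1; rewrite ler01 lexx => /(_ isT) u1.
  have := le_trans u1 uS.
  by rewrite /u mulr1 scale1r mul1mx expRN mulrC ler_pdivrMr ?expR_gt0.
have [S01 _] := SP w; move: S01; rewrite in_itv/= => /andP[S0 S1].
have [->|SN0] := eqVneq (S w) 0.
  by rewrite /u mulr0 expR0 mul1r scale0r complexify0.
have {SN0}S0 : 0 < S w by rewrite lt_def SN0.
set s := S w in S0 S1 wmax *.
have wreg al : al \in Phi -> dot al (w *m x) != 0.
  move=> alPhi; rewrite dotC dot_mulmxl dotC xreg//.
  by have [] := in_weyl_group_stable rsPhi wW alPhi.
have smax r : 0 <= r <= s -> u w r <= u w s.
  by move=> /andP[r0 rs]; rewrite wmax// r0 (le_trans rs).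
have d0 := derive_at_max S0 (du w s) smax.
have fmax al : al \in Phip ->
    csqr (f (complexify (refl_mx al *m (s *: (w *m x)))))
    <= csqr (f (complexify (s *: (w *m x)))).
  move=> /PhipS alPhi.
  have := wmax _ s (in_weyl_groupM alPhi wW); rewrite (ltW S0) S1 => /(_ isT).
  by rewrite /u ler_pM2l ?expR_gt0// -mulmxA scalemxAr.
have := eigenfunction_growth (fun al h => k0 _ (PhipS _ h)) eigf S0
  (fun al h => wreg _ (PhipS _ h)) fmax.
move: d0; rewrite pmulr_rge0 ?expR_gt0// /u.
have := lamb _ wW.
have := cdot2_ge0 (f (complexify (s *: (w *m x)))).
move: (cdot2 (f _) (f (complexify (s *: (w *m x))))) => N.
move: (cdot2 _ _) (complex.Re _) => D a N0 ab h1 h2.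
(* The derivative test gives [b N <= D], the growth estimate [D <= a N]. Since [a < b] strictly, [N]
   must vanish. *)
suff -> : N = 0 by rewrite mulr0.
by apply/eqP; rewrite eq_le N0 andbT; nra.
Qed.

Lemma near_all_seq (T : eqType) (U : Type) (F : set_system U) (s : seq T)
  (P : T -> U -> Prop) : Filter F ->
  (forall a, a \in s -> \forall e \near F, P a e) ->
  \forall e \near F, forall a, a \in s -> P a e.
Proof.
move=> FF; elim: s => [|a s IH] sP; first exact: nearW.
have := sP a (mem_head _ _).
have := IH (fun b bs => sP b (@mem_behead _ (a :: s) b bs)).
by apply: filterS2 => e es ea b; rewrite inE => /predU1P[->|/es].
Qed.

(** The regular case is applied at [x + e v], with [v] the regular vector defining the positive
    system, and with exponent [b + e C]. Letting [e] tend to 0 from the right removes both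
    regularity and strictness. *)
Lemma eigenfunction_bound Phi Phip k lam f x b :
  crystallographic_root_system Phi -> positive_subsystem Phi Phip ->
  (forall al, al \in Phi -> 0 <= k al) ->
  cherednik_eigenfunction Phip k (lam - complexify (rho Phip k)) f ->
  (forall w, in_weyl_group Phi w ->
    complex.Re (dot lam (complexify (w *m x))) <= b) ->
  `|f (complexify x)| <= `|f 0| * (expR b)%:C.
Proof.
move=> rsPhi psPhi k0 eigf lamb; have [df _] := eigf.
suff le2 : csqr (f (complexify x)) <=
    csqr (f 0) * expR (2 * b).
  rewrite -(@ler_pXn2r _ 2)// ?nnegrE ?mulr_ge0 ?normr_ge0 ?lecR ?expR_ge0//.
  by rewrite exprMn !sqr_normc_cdot2 -rmorphXn -rmorphM lecR -expRM_natl.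
have [v [v0 PhipE]] := psPhi.
(* The summand 1 makes [C] strictly larger than each real part contributed by [w v]. *)
pose C := 1 + \sum_(w <- weyl_group Phi)
  `|complex.Re (dot lam (complexify (w *m v)))|.
pose g (e : R) := csqr (f (complexify (x + e *: v))).
pose h (e : R) := csqr (f 0) * expR (2 * (b + e * C)).
have cg : g e @[e --> 0^'+] --> g 0.
  apply: cvg_at_right_filter; apply: derivable_line_continuous => s; exact: df.
have ch : h e @[e --> 0^'+] --> h 0.
  apply: cvg_at_right_filter; apply: cvgM; first exact: cvg_cst.
  apply: continuous_comp; last exact: continuous_expR.
  apply: cvgM; first exact: cvg_cst.
  apply: cvgD; first exact: cvg_cst.
  by apply: cvgM; [exact: cvg_id|exact: cvg_cst].
suff : g 0 <= h 0 by rewrite /g /h scale0r mul0r !addr0.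
apply: (ler_cvg_to cg ch).
(* Along [x + e v] each root is affine in [e] with nonzero slope, so its only zero is avoided by
   small positive [e]. *)
have reg : \forall e \near (0 : R)^'+,
    forall al, al \in Phi -> dot al (x + e *: v) != 0.
  apply: near_all_seq => al alPhi.
  have [ax0|ax0] := eqVneq (dot al x) 0.
    near=> e; rewrite dotDr dotZr ax0 add0r mulf_eq0 negb_or v0// andbT.
    by rewrite gt_eqF.
  near=> e; rewrite dotDr dotZr addr_eq0.
  apply/negP => /eqP axE.
  have : e < `|dot al x| / `|dot al v|.
    by near: e; apply: nbhs_right_lt; rewrite divr_gt0// normr_gt0// v0.
  rewrite axE normrN normrM mulfK ?normr_eq0 ?v0// gtr0_norm//.
  by rewrite ltxx.
near=> e; rewrite /g /h.
have e0 : 0 < e by [].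
apply: (eigenfunction_bound_regular rsPhi psPhi k0 eigf).
  exact: (near reg e).
move=> w wW; rewrite mulmxDr -scalemxAr complexifyDZ.
rewrite dotDr dot_scaler.
have -> z : complex.Re (dot lam (complexify (w *m x)) + e%:C * z) =
    complex.Re (dot lam (complexify (w *m x))) + e * complex.Re z.
  by case: (dot _ _) z => [? ?] [? ?]/=; rewrite mul0r subr0.
rewrite ler_ltD ?lamb// ltr_pM2l// /C.
rewrite (big_rem w)/=; last exact/in_weyl_groupP.
apply: (@le_lt_trans _ _ `|complex.Re (dot lam (complexify (w *m v)))|).
  exact: ler_norm.
by rewrite addrCA ltrDl ltr_wpDr// sumr_ge0.
Unshelve. all: by end_near.
Qed.
End Eigenfunctions.

(** * Linearity and uniqueness of eigenfunctions *)

Section Intertwiner.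
Context {R : realType} {n : nat}.
Implicit Types (Phi Phip : {fset 'cV[R]_n}) (k : 'cV[R]_n -> R).
Implicit Types (f : 'cV[R[i]]_n -> R[i]) (x v al : 'cV[R]_n) (w : 'M[R]_n).

Lemma derivable_mulmx f (A : 'M[R[i]]_n) (p q : 'cV[R[i]]_n) :
  derivable f (A *m p) (A *m q) -> derivable (fun t => f (A *m t)) p q.
Proof.
rewrite /derivable [X in _ -> cvg (X @ _)](_ : _ =
  (fun h => h^-1 *: ((f \o shift (A *m p)) (h *: (A *m q)) - f (A *m p))))//.
by apply/funext => h /=; rewrite mulmxDr -scalemxAr.
Qed.

Lemma derive_mulmx f (A : 'M[R[i]]_n) (p q : 'cV[R[i]]_n) :
  'D_q (fun t => f (A *m t)) p = 'D_(A *m q) f (A *m p).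
Proof.
rewrite /derive [X in lim (X @ _)](_ : _ =
  (fun h => h^-1 *: ((f \o shift (A *m p)) (h *: (A *m q)) - f (A *m p))))//.
by apply/funext => h /=; rewrite mulmxDr -scalemxAr.
Qed.

Definition reflection_part Phip k xi f x : R[i] :=
  \sum_(al <- Phip) (k al * dot al xi)%:C
      * ((f (complexify x) - f (complexify (refl_mx al *m x)))
         / (1 - cexp (- dot (complexify al) (complexify x)))).

Lemma cherednikE Phip k xi f x : cherednik Phip k xi f (complexify x) =
  'D_(complexify xi) f (complexify x) + reflection_part Phip k xi f x
  - (dot (rho Phip k) xi)%:C * f (complexify x).
Proof.
by rewrite /reflection_part; under [in RHS]eq_bigr do rewrite complexify_mulmx.
Qed.

Lemma reflection_partD Phip k xi f g (c : R[i]) x :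
  reflection_part Phip k xi (fun t => f t + c * g t) x =
  reflection_part Phip k xi f x + c * reflection_part Phip k xi g x.
Proof.
rewrite /reflection_part mulr_sumr -big_split; apply: eq_bigr => al _ /=.
by move: (f _) (f _) (g _) (g _) (_^-1) (_%:C) => *; ring.
Qed.

Lemma deriveDM f g (c : R[i]) (p q : 'cV[R[i]]_n) :
  derivable f p q -> derivable g p q ->
  'D_q (fun t => f t + c * g t) p = 'D_q f p + c * 'D_q g p.
Proof.
by move=> df dg; rewrite (deriveD df (derivableZ dg)) (deriveZ _ dg).
Qed.

Lemma derivableDM f g (c : R[i]) (p q : 'cV[R[i]]_n) :
  derivable f p q -> derivable g p q ->
  derivable (fun t => f t + c * g t) p q.
Proof. move=> df dg; exact: (derivableD df (derivableZ dg)). Qed.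

Lemma cherednik_eigenfunctionD Phip k mu f g (c : R[i]) :
  cherednik_eigenfunction Phip k mu f -> cherednik_eigenfunction Phip k mu g ->
  cherednik_eigenfunction Phip k mu (fun t => f t + c * g t).
Proof.
move=> [df fE] [dg gE]; split=> [x v|xi x xreg]; first exact: derivableDM.
rewrite [RHS]mulrDr [in RHS]mulrCA -(fE _ _ xreg) -(gE _ _ xreg) !cherednikE.
rewrite reflection_partD (deriveDM _ (df _ _) (dg _ _)).
move: (reflection_part _ _ _ f _) (reflection_part _ _ _ g _).
by move: ('D_ _ f _) ('D_ _ g _) (f _) (g _) (_%:C) => *; ring.
Qed.

Lemma cherednik_eigenfunction_eq0 Phi Phip k mu f x :
  crystallographic_root_system Phi -> positive_subsystem Phi Phip ->
  (forall al, al \in Phi -> 0 <= k al) ->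
  cherednik_eigenfunction Phip k mu f -> f 0 = 0 -> f (complexify x) = 0.
Proof.
move=> rsPhi psPhi k0; rewrite -[mu](addrK (complexify (rho Phip k))).
move=> eigf f0.
(* Any upper bound over W serves as exponent, as the exponential is multiplied by [f 0 = 0]. *)
have := @eigenfunction_bound _ _ _ _ _ _ _ x (\sum_(w <- weyl_group Phi)
  `|complex.Re (dot (mu + complexify (rho Phip k)) (complexify (w *m x)))|)
  rsPhi psPhi k0 eigf.
rewrite f0 normr0 mul0r normr_le0 => bnd; apply/eqP/bnd => w wW.
rewrite (big_rem w)/=; last exact/in_weyl_groupP.
by rewrite (le_trans (ler_norm _))// lerDl sumr_ge0.
Qed.

Lemma dot_refl al x v : dot (refl_mx al *m x) (refl_mx al *m v) = dot x v.
Proof. by rewrite dot_mulmxl trmx_refl_mx mulmxA refl_mxK mul1mx. Qed.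

Lemma dot_reflC al x v : dot x (refl_mx al *m v) = dot (refl_mx al *m x) v.
Proof. by rewrite dot_mulmxl trmx_refl_mx. Qed.

Lemma refl_mx_conj x v :
  refl_mx (refl_mx x *m v) = refl_mx x *m refl_mx v *m refl_mx x.
Proof.
apply: mulmx_col_inj => y; rewrite -!mulmxA refl_mxE (refl_mxE v) mulmxBr.
by rewrite mulmxA refl_mxK mul1mx -scalemxAr dot_refl dot_reflC.
Qed.

Lemma simple_reflection_sum (V : nmodType) Phip al (g : 'cV[R]_n -> V) :
  \sum_(be <- Phip | refl_mx al *m be \in Phip) g be =
  \sum_(be <- Phip | refl_mx al *m be \in Phip) g (refl_mx al *m be).
Proof.
pose A := [fset be in Phip | refl_mx al *m be \in Phip]%fset.
have reflK be : refl_mx al *m (refl_mx al *m be) = be.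
  by rewrite mulmxA refl_mxK mul1mx.
have AE (h : 'cV[R]_n -> V) :
    \sum_(be <- Phip | refl_mx al *m be \in Phip) h be = \sum_(be <- A) h be.
  by rewrite big_fset.
rewrite !AE -(perm_big _ (perm_map_fset _ _ :
  perm_eq (map (mulmx (refl_mx al)) A) A)).
- by rewrite big_map.
- by move=> b1 b2 _ _ /(congr1 (mulmx (refl_mx al))); rewrite !reflK.
- by move=> be; rewrite !inE/= reflK => /andP[-> ->].
Qed.

(* For al simple, rho minus its reflection in al is simple_multiplicity al times
   al; the sum runs over the positive multiples of al in Phi. *)
Definition simple_multiplicity Phip k al : R :=
  (\sum_(be <- Phip | refl_mx al *m be \notin Phip) k be * dot be al)
  / dot al al.

(** * Simple reflections: intertwiners and invariance in the spectral parameter *)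

Section SimpleRoot.
Context {Phi Phip : {fset 'cV[R]_n}} {k : 'cV[R]_n -> R} {al : 'cV[R]_n}.
Context (rsPhi : crystallographic_root_system Phi).
Context (psPhi : positive_subsystem Phi Phip).
Context (kW : multiplicity_function Phi k) (sal : simple_root Phip al).

Let PhipS be : be \in Phip -> be \in Phi.
Proof. by case: psPhi => v [_ ->] /andP[]. Qed.

Let alPhi : al \in Phi. Proof. by apply: PhipS; case: sal. Qed.

Let aa0 : 0 < dot al al. Proof. exact/dotxx_gt0/(root_neq0 rsPhi). Qed.

Let kre be : be \in Phi -> k (refl_mx al *m be) = k be.
Proof.
by apply: kW; apply/in_weyl_groupP => //; exact: in_weyl_group_refl.
Qed.

Let multiple be : be \in Phip -> refl_mx al *m be \notin Phip ->
  be = (dot be al / dot al al) *: al.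
Proof.
case: sal => _ /[apply] -[->//|[c ->] _].
by rewrite dotZl mulfK// gt_eqF.
Qed.

Let refl_multiple_mx be : be \in Phip -> refl_mx al *m be \notin Phip ->
  refl_mx be = refl_mx al.
Proof.
move=> bp nbp; rewrite (multiple bp nbp) refl_mxZ//.
apply: contraTneq (PhipS bp) => c0.
by rewrite (multiple bp nbp) c0 scale0r; case: rsPhi.
Qed.

Let refl_multiple be : be \in Phip -> refl_mx al *m be \notin Phip ->
  refl_mx al *m be = - be.
Proof.
move=> bp nbp; rewrite -(refl_multiple_mx bp nbp) refl_mxN//.
by rewrite (root_neq0 rsPhi)// PhipS.
Qed.

Lemma simple_multiplicityE x :
  \sum_(be <- Phip | refl_mx al *m be \notin Phip) k be * dot be x
  = simple_multiplicity Phip k al * dot al x.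
Proof.
rewrite /simple_multiplicity -mulrA mulr_suml big_seq_cond [RHS]big_seq_cond.
apply: eq_bigr => be /andP[bp nbp]; rewrite {2}(multiple bp nbp) dotZl.
by rewrite -!mulrA.
Qed.

(** The simple reflection permutes the positive roots that stay positive, so these contribute
    equally to both sums. The multiples of [al] are compared term by term and leave the correction
    [g3]. *)
Lemma sum_simple_reflection (V : zmodType) (g1 g2 g3 : 'cV[R]_n -> V) :
  (forall be, be \in Phip -> g1 be = g2 (refl_mx al *m be)) ->
  (forall be, be \in Phip -> refl_mx al *m be \notin Phip ->
    g1 be = g2 be + g3 be) ->
  \sum_(be <- Phip) g1 be = \sum_(be <- Phip) g2 be +
    \sum_(be <- Phip | refl_mx al *m be \notin Phip) g3 be.
Proof.
move=> g12 g123; rewrite (bigID (fun be => refl_mx al *m be \in Phip)).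
rewrite [X in _ = X + _](bigID (fun be => refl_mx al *m be \in Phip))/= -addrA.
rewrite [X in _ = X + _]simple_reflection_sum -big_split/=.
rewrite big_seq_cond [X in _ + X]big_seq_cond [X in _ = X + _]big_seq_cond.
rewrite [X in _ = _ + X]big_seq_cond.
congr (_ + _); apply: eq_bigr => be /andP[bp nbp]; first exact: g12.
exact: g123.
Qed.

Lemma dot_rho_refl x : dot (rho Phip k) (refl_mx al *m x)
  = dot (rho Phip k) x - simple_multiplicity Phip k al * dot al x.
Proof.
have rhoE z : dot (rho Phip k) z = 2^-1 * \sum_(be <- Phip) k be * dot be z.
  rewrite /rho dotZl dot_suml; congr (_ * _).
  by apply: eq_bigr => ? _; rewrite dotZl.
have sE : \sum_(be <- Phip) k be * dot be x = \sum_(be <- Phip)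
    k be * dot be (refl_mx al *m x) +
    \sum_(be <- Phip | refl_mx al *m be \notin Phip) 2 * (k be * dot be x).
  apply: sum_simple_reflection => be bp; first by rewrite dot_refl kre// PhipS.
  move=> nbp; rewrite dot_reflC refl_multiple// dotNl; ring.
by rewrite !rhoE sE -mulr_sumr simple_multiplicityE; field.
Qed.

Lemma refl_simple_regular x : regular_point Phip (complexify x) ->
  regular_point Phip (complexify (refl_mx al *m x)).
Proof.
move=> /regular_point_complexify xreg; apply/regular_point_complexify => be bp.
rewrite dot_reflC; have [_ stable _] := rsPhi; have [v [v0 PhipE]] := psPhi.
have sPhi := stable _ _ alPhi (PhipS bp).
have [/xreg//|sn] := boolP (refl_mx al *m be \in Phip).
have := xreg _ (opp_positive_root rsPhi v0 PhipE sPhi sn).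
by rewrite dotNl oppr_eq0.
Qed.

(** Roots that stay positive are exchanged by conjugating reflections. For a multiple of [al],
    reflecting changes the sign of its value [u] at [x], and [1 / (1 - e^(-u)) + 1 / (1 - e^u) = 1]
    leaves a correction without denominator. *)
Lemma reflection_part_refl f xi x : regular_point Phip (complexify x) ->
  reflection_part Phip k xi (fun t => f (complexify (refl_mx al) *m t)) x =
  reflection_part Phip k (refl_mx al *m xi) f (refl_mx al *m x) +
  (simple_multiplicity Phip k al * dot al xi)%:C *
     (f (complexify (refl_mx al *m x)) - f (complexify x)).
Proof.
move=> xreg; have yreg := refl_simple_regular xreg.
have reflK z : refl_mx al *m (refl_mx al *m z) = z.
  by rewrite mulmxA refl_mxK mul1mx.
rewrite -simple_multiplicityE rmorph_sum/= mulr_suml.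
apply: sum_simple_reflection => be bp; rewrite -!complexify_mulmx.
  rewrite refl_mx_conj -!mulmxA !reflK !dot_complexify !dot_refl kre//.
  exact: PhipS.
move=> nbp; rewrite (refl_multiple_mx bp nbp) !reflK !dot_complexify !dot_reflC.
move: (yreg _ bp) (xreg _ bp); rewrite (refl_multiple bp nbp).
rewrite !dot_complexify !dot_reflC (refl_multiple bp nbp) !dotNl mulrN.
have cN (r : R) : (- r)%:C = - r%:C :> R[i] by rewrite rmorphN.
have cV (r : R) : (expR (- r))%:C = (expR r)%:C^-1 :> R[i].
  by rewrite expRN fmorphV.
rewrite -!cN opprK !cexp_real cV cN.
have : (expR (dot be x))%:C != 0 :> R[i] by rewrite fmorph_eq0 gt_eqF ?expR_gt0.
move: (f _) (f _) ((expR _)%:C) ((k _ * _)%:C) => a b e c e0 e1 e2.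
by field; rewrite e0 !subr_eq0 eq_sym e1.
Qed.

(** Let [s] be the reflection and [m] the simple multiplicity. The corrections from the reflection
    terms and from [rho] combine so that the operator in direction [xi] sends [f o s] to
    [<s lam, xi> f o s - m <al, xi> f]. Adding [c f] gives an eigenfunction when
    [c <lam - s lam, xi> = m <al, xi>], which is the condition on [c]. *)
Lemma intertwiner f (lam : 'cV[R[i]]_n) c :
  c * (2 * dot lam (complexify al)) =
    (simple_multiplicity Phip k al * dot al al)%:C ->
  cherednik_eigenfunction Phip k lam f ->
  cherednik_eigenfunction Phip k (complexify (refl_mx al) *m lam)
    (fun t => f (complexify (refl_mx al) *m t) + c * f t).
Proof.
move=> cE [df fE].
have dg x v : derivable (fun t => f (complexify (refl_mx al) *m t))
    (complexify x) (complexify v).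
  by apply: derivable_mulmx; rewrite -!complexify_mulmx.
split=> [x v|xi x xreg]; first exact: derivableDM.
have yreg := refl_simple_regular xreg.
have cN (r : R) : (- r)%:C = - r%:C :> R[i] by rewrite rmorphN.
have {}cE : (simple_multiplicity Phip k al * dot al xi)%:C =
    c * (dot lam (complexify xi) - dot lam (complexify (refl_mx al *m xi))).
  rewrite refl_mxE -scaleNr complexifyDZ dotDr dot_scaler opprD addrA.
  rewrite subrr add0r cN mulNr opprK.
  transitivity (c * (2 * dot lam (complexify al)) * (dot al xi / dot al al)%:C).
    rewrite cE -rmorphM/=; congr (_%:C); field; exact: lt0r_neq0.
  rewrite -[LHS]mulrA; congr (c * _).
  rewrite [(2 / _ * _)%:C](_ : _ = 2 * (dot al xi / dot al al)%:C).
    by ring.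
  by rewrite !rmorphM/= rmorph_nat; ring.
have lamE : dot (complexify (refl_mx al) *m lam) (complexify xi)
  = dot lam (complexify (refl_mx al *m xi)).
  by rewrite dot_mulmxl /complexify map_trmx trmx_refl_mx -map_mxM.
have := fE xi x xreg; have := fE (refl_mx al *m xi) _ yreg.
rewrite !cherednikE reflection_partD reflection_part_refl// lamE.
rewrite (deriveDM _ (dg _ _) (df _ _)) derive_mulmx -!complexify_mulmx.
rewrite dot_rho_refl rmorphB/= cE.
move: (reflection_part _ _ _ _ _) (reflection_part _ _ _ _ _) => S0 S2.
move: ('D_ _ _ _) ('D_ _ _ _) (f _) (f _) (dot lam _) (dot lam _) (_%:C).
move=> D0 D2 f0 f2 L2 L0 r E2 E0.
transitivity (L2 * f2 + c * (L0 * f0) - c * (L0 - L2) * f0); last by ring.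
by rewrite -E2 -E0; ring.
Qed.

Lemma sum_weyl_mulr (V : nmodType) w (g : 'M[R]_n -> V) :
  in_weyl_group Phi w ->
  \sum_(u <- weyl_group Phi) g u = \sum_(u <- weyl_group Phi) g (u *m w).
Proof.
move=> wW; have wwT := in_weyl_group_orthogonal wW.
rewrite -(perm_big _ (perm_map_fset _ _ :
  perm_eq (map (fun u => u *m w) (weyl_group Phi)) (weyl_group Phi))).
- by rewrite big_map.
- by move=> u1 u2 _ _ /(congr1 (mulmx^~ w^T)); rewrite -!mulmxA wwT !mulmx1.
- move=> u /in_weyl_groupP => /(_ rsPhi) uW; apply/in_weyl_groupP => //.
  exact: in_weyl_groupMM.
Qed.

Lemma hypergeometric_complexify G (lam : 'cV[R[i]]_n) x :
  hypergeometric Phi G lam (complexify x) =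
  (#|` weyl_group Phi|%fset)%:R^-1
  * \sum_(w <- weyl_group Phi) G lam (complexify (w^T *m x)).
Proof.
congr (_ * _); rewrite big_seq [RHS]big_seq; apply: eq_bigr => w.
move=> /in_weyl_groupP => /(_ rsPhi) /in_weyl_group_invmx ->.
by rewrite complexify_mulmx.
Qed.

Lemma refl_mx_complexifyE (mu : 'cV[R[i]]_n) :
  complexify (refl_mx al) *m mu =
  mu - ((2 / dot al al)%:C * dot mu (complexify al)) *: complexify al.
Proof.
rewrite /refl_mx /complexify map_mxB map_mx1 map_mxZ map_mxM mulmxBl mul1mx.
rewrite -scalemxAl -mulmxA -scalerA; congr (_ - _ *: _); apply/colP => i.
rewrite !mxE big_ord1 !mxE mulrC dot_comm; congr (_ * _).
by apply: eq_bigr => j _; rewrite !mxE.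
Qed.

(** Generically, intertwiner and uniqueness give [G(mu; s y) + c G(mu; y) = (1 + c) G(s mu; y)].
    Averaging over W multiplies both hypergeometric functions by [1 + c], which can be cancelled
    when it is nonzero. *)
Lemma hypergeometric_simple G (lam : 'cV[R[i]]_n) x :
  (forall be, be \in Phi -> 0 <= k be) ->
  (forall mu, cherednik_eigenfunction Phip k mu (G mu)) ->
  (forall mu, G mu 0 = 1) ->
  hypergeometric Phi G (complexify (refl_mx al) *m lam) (complexify x)
  = hypergeometric Phi G lam (complexify x).
Proof.
move=> k0 Geig G0; pose s := complexify (refl_mx al).
pose ka := simple_multiplicity Phip k al * dot al al.
pose d mu : R[i] := 2 * dot mu (complexify al).
have ds mu : d (s *m mu) = - d mu.
  rewrite /d dot_mulmxl /s /complexify map_trmx trmx_refl_mx -map_mxM refl_mxN.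
    by rewrite map_mxN -scaleN1r dot_scaler mulN1r mulrN.
  exact: root_neq0 rsPhi alPhi.
have generic mu : d mu != 0 -> d mu != - ka%:C ->
  hypergeometric Phi G (s *m mu) (complexify x) =
    hypergeometric Phi G mu (complexify x).
  move=> d0 dka; pose c := ka%:C / d mu.
  have c1 : 1 + c != 0.
    by rewrite -(divff d0) -mulrDl mulf_neq0 ?invr_eq0 ?addr_eq0.
  have cE : c * d mu = ka%:C by rewrite divfK.
  have Gs y : G mu (complexify (refl_mx al *m y)) + c * G mu (complexify y)
      = (1 + c) * G (s *m mu) (complexify y).
    (* The difference of the two sides is an eigenfunction with parameter [s mu] vanishing at 0. *)
    have eig := cherednik_eigenfunctionD (- (1 + c))
      (intertwiner cE (Geig mu)) (Geig (s *m mu)).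
    have := cherednik_eigenfunction_eq0 y rsPhi psPhi k0 eig.
    rewrite !mulmx0 !G0 -complexify_mulmx !mulNr => /(_ _)/wrap[|/eqP].
      by ring.
    by rewrite subr_eq0 => /eqP.
  rewrite !hypergeometric_complexify; congr (_ * _); apply: (mulfI c1).
  rewrite mulr_sumr (eq_bigr _ (fun u _ => esym (Gs (u^T *m x)))) big_split/=.
  rewrite mulrDl mul1r mulr_sumr; congr (_ + _).
  rewrite [RHS](sum_weyl_mulr _ (in_weyl_group_refl alPhi)).
  by apply: eq_bigr => u _; rewrite trmx_mul trmx_refl_mx mulmxA.
have [d0|d0] := eqVneq (d lam) 0.
  have l0 : dot lam (complexify al) = 0.
    by move/eqP: d0; rewrite mulf_eq0 pnatr_eq0/= => /eqP.
  by rewrite refl_mx_complexifyE l0 mulr0 scale0r subr0.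
(* In the exceptional case [1 + c] vanishes for [lam]. But [d (s lam) = ka] is nonzero, so [s lam]
   is generic and the identity is read from [s lam] to [lam]. *)
have [dka|dka] := eqVneq (d lam) (- ka%:C); last exact: generic.
have sK : s *m (s *m lam) = lam.
  by rewrite mulmxA -[s *m s]map_mxM refl_mxK map_mx1 mul1mx.
rewrite -[in RHS]sK [RHS]generic// ds ?oppr_eq0// dka opprK.
by rewrite -subr_eq0 opprK -mulr2n mulrn_eq0/= -oppr_eq0 -dka.
Qed.

End SimpleRoot.
End Intertwiner.

(** * The longest element on rho, and the final estimate *)

Lemma rho_longest (R : realType) (n : nat) (Phi Phip : {fset 'cV[R]_n}) k w :
  crystallographic_root_system Phi -> positive_subsystem Phi Phip ->
  multiplicity_function Phi k -> in_weyl_group Phi w ->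
  (forall al, al \in Phip -> - (w^T *m al) \in Phip) ->
  w *m rho Phip k = - rho Phip k.
Proof.
move=> rsPhi [v [_ PhipE]] kW wW wN.
have wwT := in_weyl_group_orthogonal wW.
(* [k] is even because [- al] is the reflection of [al] in its own hyperplane. *)
have kN al : al \in Phi -> k (- al) = k al.
  move=> alPhi; rewrite -refl_mxN ?(root_neq0 rsPhi)//; apply: kW => //.
  exact/in_weyl_groupP/in_weyl_group_refl.
have wTr : w^T *m rho Phip k = - rho Phip k.
  rewrite /rho -scalemxAr -scalerN; congr (_ *: _).
  (* The map sending [al] to [- w^T al] permutes the positive roots, so the sum on the right is
     reindexed by it. *)
  rewrite -[in RHS](perm_big _ (perm_map_fset _ wN)) /=; last first.
    move=> a1 a2 _ _ /oppr_inj /(congr1 (mulmx w)).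
    by rewrite !mulmxA wwT !mul1mx.
  rewrite big_map mulmx_sumr -sumrN big_seq [RHS]big_seq.
  apply: eq_bigr => al; rewrite PhipE => /andP[alPhi _].
  have [_ walPhi] := in_weyl_group_stable rsPhi wW alPhi.
  rewrite kN// -scalemxAr scalerN opprK kW//.
  exact/in_weyl_groupP/in_weyl_group_tr.
by rewrite -[in LHS](opprK (rho _ _)) -wTr mulmxN mulmxA wwT mul1mx.
Qed.

Theorem corollary3p4 (R : realType) (n : nat)
    (Phi Phip : {fset 'cV[R]_n}) (k : 'cV[R]_n -> R)
    (G : 'cV[R[i]]_n -> 'cV[R[i]]_n -> R[i])
    (hPhi : crystallographic_root_system Phi)
    (hPhip : positive_subsystem Phi Phip)
    (hk : multiplicity_function Phi k)
    (hk0 : forall al, al \in Phi -> 0 <= k al)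
    (hG : cherednik_opdam_kernel Phi Phip k G)
    (lam : 'cV[R[i]]_n) (t : 'cV[R]_n) :
  `|hypergeometric Phi G (lam + complexify (rho Phip k)) (complexify t)|
  <= (expR (\big[Order.max/complex.Re (dot lam (complexify t))]_(w <- weyl_group Phi)
              complex.Re (dot (complexify w *m lam) (complexify t))))%:C.
Proof.
have [Om [[_ Om0 _] [dG GE G0]]] := hG.
(* Real points have imaginary part 0, which lies in [Om]. *)
have tubeR x : tube Om (complexify x).
  rewrite /tube/= (_ : map_mx _ _ = 0)//.
  by apply/matrixP => i j; rewrite !mxE.
have Geig mu : cherednik_eigenfunction Phip k mu (G mu).
  split=> [x v|xi x xreg]; last exact: GE.
  (* Joint differentiability is restricted to directions that leave the spectral parameter fixed. *)
  have := @diff_derivable _ _ _ _ _ (0, complexify v) (dG mu _ (tubeR x)).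
  rewrite /derivable [X in cvg (X @ _) -> _](_ : _ = (fun h => h^-1 *:
    ((G mu \o shift (complexify x)) (h *: complexify v)
     - G mu (complexify x))))//.
  by apply/funext => h /=; rewrite scaler0 add0r.
(* Passing this property to [longest_element] yields invariance under the longest element from
   simple reflections alone. *)
pose inv (w : 'M[R]_n) := forall mu x,
  hypergeometric Phi G (complexify w *m mu) (complexify x)
  = hypergeometric Phi G mu (complexify x).
have inv1 : inv 1%:M by move=> mu x; rewrite [complexify 1%:M]map_mx1 mul1mx.
have invM al u : simple_root Phip al -> inv u -> inv (refl_mx al *m u).
  move=> sal Fu mu x; rewrite complexify_mulmx -mulmxA.
  by rewrite (hypergeometric_simple hPhi hPhip hk sal).
have [w [wW Fw wN]] := longest_element hPhi hPhip inv1 invM.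
(* The default value of this maximum is the term of the identity, so [b] is the maximum over W
   itself. *)
set b := \big[_/_]_(_ <- _) _.
have bmax u : in_weyl_group Phi u ->
    complex.Re (dot (complexify u *m lam) (complexify t)) <= b.
  by move=> /in_weyl_groupP => /(_ hPhi) uW; exact: (le_bigmax_seq _ u xpredT
    (fun u => complex.Re (dot (complexify u *m lam) (complexify t)))).
(* The parameter [lam + rho] becomes [w lam - rho], the form to which [eigenfunction_bound]
   applies. *)
rewrite -Fw mulmxDr -complexify_mulmx (rho_longest hPhi hPhip hk wW wN).
rewrite [complexify (- _)]map_mxN hypergeometric_complexify//.
have N0 : (0 < #|` weyl_group Phi|)%N.
  rewrite cardfs_gt0; apply/fset0Pn; exists 1%:M.
  by apply/in_weyl_groupP => //; constructor.
rewrite normrM normfV normr_nat ler_pdivrMl ?ltr0n//.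
apply: (le_trans (ler_norm_sum _ _ _)).
apply: (@le_trans _ _ (\sum_(u <- weyl_group Phi) (expR b)%:C)); last first.
  by rewrite big_const_seq count_predT iter_addr_0 mulr_natl.
rewrite big_seq [leRHS]big_seq; apply: ler_sum => u.
move=> /in_weyl_groupP => /(_ hPhi) uW.
(* Moving all group elements onto [lam] gives a point of its W-orbit, so neither [w] nor [u] affects
   the bound [b]. *)
have lamu w' : in_weyl_group Phi w' ->
    complex.Re (dot (complexify w *m lam) (complexify (w' *m (u^T *m t)))) <= b.
  move=> w'W.
  have -> : dot (complexify w *m lam) (complexify (w' *m (u^T *m t)))
    = dot (complexify (u *m w'^T *m w) *m lam) (complexify t).
    rewrite !complexify_mulmx -!mulmxA [RHS]dot_mulmxl [in RHS]dot_mulmxl.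
    by rewrite /complexify !map_trmx trmxK.
  apply: bmax; apply: in_weyl_groupMM => //; apply: in_weyl_groupMM => //.
  exact: in_weyl_group_tr.
have := eigenfunction_bound hPhi hPhip hk0
  (Geig (complexify w *m lam - complexify (rho Phip k))) lamu.
by rewrite G0 normr1 mul1r.
Qed.
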